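(* Let $f\in C(\mathbb{R};\mathbb{R})$ satisfy $xf(x)>0$ for all $x\ne0$, $f(0)=0$, $\lim_{x\to-\infty}f(x)=-\infty$ and $\lim_{x\to\infty}f(x)=\infty$. Then the functions $$f^+(x)=\sup\{z>0:f(z)=x\},\ x\ge0,\qquad f^-(x)=\inf\{z<0:f(z)=x\},\ x\le0,$$ are well-defined, and with $$x_+(y)=\sup\Big\{x>0:\min_{a\in[-y,y]}f(x+a)=y\Big\},\qquad -x_-(y)=\inf\Big\{x<0:\max_{a\in[-y,y]}f(x+a)=-y\Big\},\quad y\ge0,$$ and $\overline{x}(f,y)=2y+\max(f^+(y),-f^-(-y))$ for $y\ge0$, we have $$y+\max(x_+(y),x_-(y))\le\overline{x}(f,y),\quad y\ge0 .$$
   Context: For the argument $0$ the defining sets are empty, and the convention is $f^+(0)=f^-(0)=0$ and $x_+(0)=x_-(0)=0$. ''Well-defined'' means that for every $x>0$ the set defining $f^+(x)$ is nonempty and bounded above, and for every $x<0$ the set defining $f^-(x)$ is nonempty and bounded below. *)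

(* Defs.v *)
(* MathComp-Analysis, over an abstract [R : realType]. *)
From mathcomp Require Import all_boot all_order all_algebra.
From mathcomp Require Import all_classical all_reals all_analysis.

Set Implicit Arguments.
Unset Strict Implicit.
Unset Printing Implicit Defensive.

Import Order.TTheory GRing.Theory Num.Theory.
Import numFieldNormedType.Exports.

Local Open Scope classical_set_scope.
Local Open Scope ring_scope.

Section Defs.
Variable R : realType.
Implicit Types (A : set R) (f : R -> R) (m x y : R).

Definition is_min A m : Prop := A m /\ lbound A m.
Definition is_max A m : Prop := A m /\ ubound A m.

Definition fplus_set f x : set R := [set z | 0 < z /\ f z = x].
Definition fminus_set f x : set R := [set z | z < 0 /\ f z = x].

(* [window f x y] is the set of values f (x + a) for a in [-y, y]. *)
Definition window f x y : set R := [set f (x + a) | a in `[- y, y]].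

Definition xplus_set f y : set R :=
  [set x | 0 < x /\ is_min (window f x y) y].
Definition xminus_set f y : set R :=
  [set x | x < 0 /\ is_max (window f x y) (- y)].

(* At the argument 0 the four sets above are empty as soon as f vanishes only
   at 0; the convention that the functions below take the value 0 there is
   that of [sup] and [inf], since [sup set0 = 0] and [inf set0 = 0]. *)
Definition fplus f x : R := sup (fplus_set f x).
Definition fminus f x : R := inf (fminus_set f x).
Definition xplus f y : R := sup (xplus_set f y).
Definition xminus f y : R := - inf (xminus_set f y).

Definition xbar f y : R := 2 * y + Num.max (fplus f y) (- fminus f (- y)).

End Defs.

(* Main.v *)
Require Import Defs.
From mathcomp Require Import all_boot all_order all_algebra.
From mathcomp Require Import all_classical all_reals all_analysis.
From mathcomp Require Import lra.

Set Implicit Arguments.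
Unset Strict Implicit.
Unset Printing Implicit Defensive.

Import Order.TTheory GRing.Theory Num.Theory.
Import numFieldNormedType.Exports.

Local Open Scope classical_set_scope.
Local Open Scope ring_scope.

(** For [y > 0] the largest solution [z = f^+(y)] of [f = y] exists, and
    [f >= y] on [[z, +oo[] by the intermediate value theorem.  Hence the minimum
    of [f] over [[z, z + 2y]] is [y], so [z + y] belongs to the set defining
    [x_+(y)]; conversely a window centred at a member of that set contains a
    positive solution of [f = y], so [z + y] is its maximum.  Thus
    [y + x_+(y) = 2y + f^+(y)], and the negative side follows by applying this
    to [x |-> - f (- x)]. *)

Lemma level_reached_above (R : realType) (f : R -> R) (a y : R) :
  continuous f -> f x @[x --> +oo] --> +oo -> f a <= y ->
  exists2 z, a <= z & f z = y.
Proof.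
move=> fc /cvgryPge /(_ y) fy fay.
have [b [ab yfb]] : exists b, a <= b /\ y <= f b.
  near (pinfty_nbhs R) => b; exists b; split; near: b.
    by apply: nbhs_pinfty_ge; rewrite num_real.
  exact: fy.
have [|c] := IVT ab (continuous_subspaceT fc) (v := y).
  by rewrite ge_min fay le_max yfb orbT.
by rewrite in_itv => /andP[ac _] fcy; exists c.
Unshelve. all: by end_near. Qed.

Lemma has_sup_fplus_set (R : realType) (f : R -> R) (y : R) :
  continuous f -> f 0 = 0 -> f x @[x --> +oo] --> +oo -> 0 < y ->
  has_sup (fplus_set f y).
Proof.
move=> fc f0 foo y0; split.
  have [|z z0 fz] := level_reached_above (a := 0) (y := y) fc foo.
    by rewrite f0 ltW.
  exists z; split=> //; rewrite lt_neqAle z0 andbT; apply: contraTneq y0 => z0'.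
  by rewrite -fz -z0' f0 ltxx.
(* Beyond some [M] all values of [f] exceed [y], so no solution of [f z = y] lies there. *)
have [M [_ fM]] := (cvgryPgt _).1 foo y.
exists M => z [_ fz]; rewrite leNgt; apply/negP => /fM.
by rewrite fz ltxx.
Qed.

(** The supremum is attained because the level set of [y] is closed by continuity. Strict positivity
    is not a closed condition; it comes from comparison with a member of the set. *)
Lemma fplus_mem (R : realType) (f : R -> R) (y : R) :
  continuous f -> f 0 = 0 -> f x @[x --> +oo] --> +oo -> 0 < y ->
  fplus_set f y (fplus f y).
Proof.
move=> fc f0 foo y0.
have hs := has_sup_fplus_set fc f0 foo y0.
have [[z Az] ubA] := hs.
split; first by apply: lt_le_trans (ub_le_sup ubA Az); case: Az.
have cl : closed (f @^-1` [set y]).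
  by apply: preimage_closed; [move=> x _; exact: fc | exact: closed_eq].
apply: (cl); apply: closureS (closure_sup (ex_intro _ z Az) ubA).
by move=> x [].
Qed.

(** If [f x < y], then [f] must climb back to the level [y] at some [w >= x], which contradicts the
    maximality of [fplus f y]. *)
Lemma le_f_of_fplus_le (R : realType) (f : R -> R) (x y : R) :
  continuous f -> f 0 = 0 -> f x @[x --> +oo] --> +oo -> 0 < y ->
  fplus f y <= x -> y <= f x.
Proof.
move=> fc f0 foo y0 Fx; rewrite leNgt; apply/negP => fxy.
have [F0 fF] := fplus_mem fc f0 foo y0.
have [w xw fw] := level_reached_above fc foo (ltW fxy).
have : w <= fplus f y.
  apply: ub_le_sup; first by case: (has_sup_fplus_set fc f0 foo y0).
  by split=> //; lra.
move=> wF; have xw' : x = w by lra.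
by move: fxy; rewrite xw' fw ltxx.
Qed.

Lemma xplus_set_mem (R : realType) (f : R -> R) (y : R) :
  continuous f -> f 0 = 0 -> f x @[x --> +oo] --> +oo -> 0 < y ->
  xplus_set f y (fplus f y + y).
Proof.
move=> fc f0 foo y0; have [F0 fF] := fplus_mem fc f0 foo y0.
split; first by lra.
split.
  (* The minimum is attained at the left end of the window, which is [fplus f y] itself. *)
  by exists (- y); rewrite ?addrK//= in_itv/=; apply/andP; split; lra.
move=> _ [a /= + <-]; rewrite in_itv/= => /andP[ya ay].
by apply: le_f_of_fplus_le => //; lra.
Qed.

Lemma xplus_set_ub (R : realType) (f : R -> R) (y : R) :
  continuous f -> (forall x, x != 0 -> 0 < x * f x) -> f 0 = 0 ->
  f x @[x --> +oo] --> +oo -> 0 < y ->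
  ubound (xplus_set f y) (fplus f y + y).
Proof.
move=> fc fs f0 foo y0 x [x0 [[a /= + fa] _]].
rewrite in_itv/= => /andP[ya ay].
suff : x + a <= fplus f y by lra.
apply: ub_le_sup; first by case: (has_sup_fplus_set fc f0 foo y0).
(* The point [x + a] is positive because [f] takes the value [y > 0] there and has the sign of its
   argument. *)
split=> //; rewrite ltNge; apply/negP; rewrite le_eqVlt => /predU1P[xa|xa].
  by move: fa y0; rewrite xa f0 => <-; rewrite ltxx.
by have := fs _ (ltr0_neq0 xa); rewrite fa nmulr_rgt0// ltNge (ltW y0).
Qed.

Lemma has_sup_xplus_set (R : realType) (f : R -> R) (y : R) :
  continuous f -> (forall x, x != 0 -> 0 < x * f x) -> f 0 = 0 ->
  f x @[x --> +oo] --> +oo -> 0 < y ->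
  has_sup (xplus_set f y).
Proof.
move=> fc fs f0 foo y0.
by split; exists (fplus f y + y); [exact: xplus_set_mem|exact: xplus_set_ub].
Qed.

Definition reflect_fun (R : realType) (f : R -> R) : R -> R :=
  fun x => - f (- x).

Lemma fminus_set_reflect (R : realType) (f : R -> R) (y : R) :
  [set - z | z in fminus_set f (- y)] = fplus_set (reflect_fun f) y.
Proof.
apply/seteqP; split=> [_ [z [z0 fz] <-]|z [z0 fz]].
  by split; rewrite ?oppr_gt0// /reflect_fun opprK fz opprK.
by exists (- z); rewrite ?opprK//; split; rewrite ?oppr_lt0// -fz opprK.
Qed.

(** By symmetry of [[- y, y]], the offset [a] on one side corresponds to [- a] on the other. *)
Lemma window_reflect (R : realType) (f : R -> R) (x y : R) :
  window (reflect_fun f) (- x) y = [set - v | v in window f x y].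
Proof.
apply/seteqP; split=> [_ [a /= aI <-]|_ [_ [a /= aI <-] <-]].
  exists (f (x - a)); last by rewrite /reflect_fun opprD opprK.
  by exists (- a) => //=; move: aI; rewrite !in_itv/= lerN2 lerNl andbC.
exists (- a) => /=; last by rewrite /reflect_fun opprD !opprK.
by move: aI; rewrite !in_itv/= lerN2 lerNl andbC.
Qed.

Lemma is_min_opp (R : realType) (A : set R) (m : R) :
  is_min [set - v | v in A] (- m) <-> is_max A m.
Proof.
split=> -[].
  move=> [v Av /oppr_inj <-] lb; split=> // w Aw.
  by rewrite -lerN2; apply: lb; exists w.
move=> Am ub; split; first by exists m.
by move=> _ [v Av <-]; rewrite lerN2; exact: ub.
Qed.

Lemma xminus_set_reflect (R : realType) (f : R -> R) (y : R) :
  [set - x | x in xminus_set f y] = xplus_set (reflect_fun f) y.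
Proof.
apply/seteqP; split=> [_ [x [x0 mx] <-]|x [x0 mx]].
  split; first by rewrite oppr_gt0.
  (* Here [y] is read as [- (- y)], so that [is_min_opp] applies with [m = - y]. *)
  by rewrite window_reflect -[X in is_min _ X]opprK; apply/is_min_opp.
exists (- x); rewrite ?opprK//; split; first by rewrite oppr_lt0.
by apply/is_min_opp; rewrite -window_reflect !opprK.
Qed.

(** Without a genuine supremum, [sup] takes its default value 0. *)
Lemma fplus_ge0 (R : realType) (f : R -> R) (x : R) : 0 <= fplus f x.
Proof.
have [[[z Az] ub]|/sup_out] := pselect (has_sup (fplus_set f x)).
  by apply: le_trans (ub_le_sup ub Az); case: Az => /ltW.
by rewrite /fplus => ->.
Qed.

Lemma xplus_le (R : realType) (f : R -> R) (y : R) :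
  continuous f -> (forall x, x != 0 -> 0 < x * f x) -> f 0 = 0 ->
  f x @[x --> +oo] --> +oo -> 0 <= y ->
  xplus f y <= fplus f y + y.
Proof.
move=> fc fs f0 foo; rewrite le_eqVlt => /predU1P[<-|y0].
  (* For [y = 0] the window is the single value [f x], nonzero for [x > 0]; the defining set is thus
     empty and its [sup] is 0. *)
  suff -> : xplus f 0 = 0 by rewrite addr0 fplus_ge0.
  rewrite /xplus (_ : xplus_set f 0 = set0) ?sup0//.
  rewrite -subset0 => x [x0 [[a /= + fa] _]].
  rewrite oppr0 in_itv/= -eq_le => /eqP a0.
  have := fs x (lt0r_neq0 x0).
  by move: fa; rewrite -a0 addr0 => ->; rewrite mulr0 ltxx.
apply: ge_sup; last exact: xplus_set_ub.
by case: (has_sup_xplus_set fc fs f0 foo y0).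
Qed.

Theorem lemma2 (R : realType) (f : R -> R)
    (f_cont : continuous f)
    (f_sign : forall x : R, x != 0 -> 0 < x * f x)
    (f_zero : f 0 = 0)
    (f_ninfty : f x @[x --> -oo] --> -oo)
    (f_pinfty : f x @[x --> +oo] --> +oo) :
  [/\ (forall x : R, 0 < x -> has_sup (fplus_set f x)),
      (forall x : R, x < 0 -> has_inf (fminus_set f x)),
      (forall y : R, 0 < y ->
         has_sup (xplus_set f y) /\ has_inf (xminus_set f y)) &
      (forall y : R, 0 <= y ->
         y + Num.max (xplus f y) (xminus f y) <= xbar f y)].
Proof.
pose g := reflect_fun f.
have g_cont : continuous g.
  move=> x; apply: continuousN; apply: continuous_comp; last exact: f_cont.
  exact: opp_continuous.
have g_sign x : x != 0 -> 0 < x * g x.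
  by move=> x0; rewrite /g /reflect_fun mulrN -mulNr f_sign// oppr_eq0.
have g_zero : g 0 = 0 by rewrite /g /reflect_fun oppr0 f_zero oppr0.
have g_pinfty : g x @[x --> +oo] --> +oo.
  apply/(cvgNry (f \o -%R)).
  exact/cvgNy_compNP.
split=> [x x0|x x0|y y0|y y0].
- exact: has_sup_fplus_set.
- apply/has_inf_supN; rewrite -[x]opprK fminus_set_reflect.
  by apply: has_sup_fplus_set; rewrite ?oppr_gt0.
- split; first exact: has_sup_xplus_set.
  by apply/has_inf_supN; rewrite xminus_set_reflect; exact: has_sup_xplus_set.
(* Since [inf] is defined as the opposite of the [sup] of the opposite set, both negative-side
   quantities become positive-side ones for [g]. *)
have -> : xminus f y = xplus g y.
  by rewrite /xminus /inf opprK xminus_set_reflect.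
have -> : xbar f y = 2 * y + Num.max (fplus f y) (fplus g y).
  by rewrite /xbar /fminus /inf opprK fminus_set_reflect.
have := xplus_le f_cont f_sign f_zero f_pinfty y0.
have := xplus_le g_cont g_sign g_zero g_pinfty y0.
have : fplus f y <= Num.max (fplus f y) (fplus g y) by rewrite le_max lexx.
have : fplus g y <= Num.max (fplus f y) (fplus g y) by rewrite le_max lexx orbT.
move: (Num.max (fplus f y) _) => m gm fm xg xf.
(* One of the two copies of [y] in [2 * y] cancels the [y] on the left. *)
suff : Num.max (xplus f y) (xplus g y) <= m + y by lra.
by rewrite ge_max; apply/andP; split; lra.
Qed.
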